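(* Let $S_2$ be the set of all nonempty partitions of the form $[5,4^k][i,j]$ with integers $k\ge 7$ and $i,j\ge 0$. Then the family of games Queen on $S_2$ is tame but not miserable, and returnable but not forced.
   Context: A partition is a finite weakly decreasing sequence $\lambda=[\lambda_1,\ldots,\lambda_r]$ of positive integers; exponents denote repetition, so $[5,4^k]$ has one part $5$ and $k$ parts $4$; $[\,]$ is the empty partition, and $\mathbb Y^+$ is the set of nonempty partitions. For $i,j\ge 0$, $\lambda[i,j]=[\lambda_{i+1}-j,\lambda_{i+2}-j,\ldots]$ with trailing nonpositive entries removed. For a moveset $M\subseteq \mathbb Z_{\ge0}^2\setminus\{(0,0)\}$ and $\lambda\in\mathbb Y^+$, the impartial chess game $(M,\lambda)$ starts at $\lambda$, and from a position $\mu\in\mathbb Y^+$ a player may move to $\mu[i,j]$ for any $(i,j)\in M$ with $\mu[i,j]\ne[\,]$. The positions of $(M,\lambda)$ are the partitions reachable from $\lambda$ by zero or more moves. A position is terminal if it has no moves. Queen has moveset $\{(k,0):k\ge1\}\cup\{(0,k):k\ge1\}\cup\{(k,k):k\ge1\}$. The Sprague-Grundy value of a position $p$ is $\mathrm{mex}$ of the Sprague-Grundy values of the positions reachable in one move ($0$ if $p$ is terminal), where $\mathrm{mex}(S)$ is the least nonnegative integer not in $S$. The misère Grundy value is defined by the same mex recursion at non-terminal positions, but terminal positions have value $1$. A position with Sprague-Grundy value $t$ and misère Grundy value $\ell$ is called a $(t,\ell)$-position. A game is returnable if for any move from a $(0,1)$-position (resp. a $(1,0)$-position) to a non-terminal position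 $y$, there is a move from $y$ to a $(0,1)$-position (resp. to a $(1,0)$-position). A game is forced if each move from a $(0,1)$-position results in a $(1,0)$-position and each move from a $(1,0)$-position results in a $(0,1)$-position. A game is tame if it has only $(0,1)$-positions, $(1,0)$-positions, and $(k,k)$-positions with $k\ge0$. A game is miserable if for every position $x$ one of the following holds: (i) $x$ is a $(0,1)$-position or a $(1,0)$-position; (ii) there is no move from $x$ to a $(0,1)$-position or a $(1,0)$-position; (iii) there are moves from $x$ to both a $(0,1)$-position and a $(1,0)$-position. For a moveset $M$ and a set $P\subseteq\mathbb Y^+$, the family $(M,P)$ has one of these properties if $(M,\lambda)$ has it for every $\lambda\in P$, and it does not have the property if $(M,\lambda)$ fails it for at least one $\lambda\in P$. *)

(* Defs.v *)
From HB Require Import structures.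
From Stdlib Require Export Relation_Operators.
From mathcomp Require Export all_boot.

Set Implicit Arguments.
Unset Strict Implicit.
Unset Printing Implicit Defensive.

Definition is_part (s : seq nat) : bool := sorted geq s && (0 \notin s).

Record int_partition := Partition { parts :> seq nat; partsP : is_part parts }.

HB.instance Definition _ := [isSub for parts].
HB.instance Definition _ := [Choice of int_partition by <:].

Definition nonempty (la : int_partition) : Prop := parts la <> [::].

(* On a weakly decreasing sequence the nonpositive entries of a translate are
   exactly a tail, so removing the trailing ones is filtering. *)
Definition cut (i j : nat) (s : seq nat) : seq nat :=
  [seq x - j | x <- drop i s & j < x].

Lemma is_part_cut (i j : nat) (s : seq nat) : is_part s -> is_part (cut i j s).
Proof.
have tr : transitive geq by move=> a b c /= H1 H2; exact: leq_trans H2 H1.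
case/andP=> ss s0; apply/andP; split.
  rewrite /cut; apply: (@homo_sorted _ _ (subn^~ j) geq geq).
    by move=> x y /= xy; exact: leq_sub2r.
  by apply: sorted_filter => //; exact: drop_sorted.
apply/negP=> /mapP[x]; rewrite mem_filter => /andP[jx _] /eqP.
by rewrite eq_sym subn_eq0 leqNgt jx.
Qed.

Definition subpart (la : int_partition) (i j : nat) : int_partition :=
  Partition (is_part_cut i j (partsP la)).

Record moveset := Moveset { inM :> rel nat; inM00 : ~~ inM 0 0 }.

Definition move (M : moveset) (mu nu : int_partition) : Prop :=
  exists i j : nat, [/\ M i j, nu = subpart mu i j & nonempty nu].

Definition position (M : moveset) (la mu : int_partition) : Prop :=
  clos_refl_trans int_partition (move M) la mu.

Definition terminal (M : moveset) (mu : int_partition) : Prop :=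
  forall nu, ~ move M mu nu.

(* [subpart mu i j] is empty unless [i < size mu] and [j < head 0 mu], so this
   finite list contains every position reachable in one move (optionsP). *)
Definition options (M : moveset) (mu : int_partition) : seq int_partition :=
  [seq nu <- [seq subpart mu p.1 p.2 |
               p <- [seq (i, j) | i <- iota 0 (size mu), j <- iota 0 (head 0 mu)]
               & M p.1 p.2]
   | parts nu != [::]].

Lemma optionsP (M : moveset) (mu nu : int_partition) :
  reflect (move M mu nu) (nu \in options M mu).
Proof.
apply: (iffP idP).
  rewrite mem_filter => /andP[/eqP nu0 /mapP[[i j]]].
  rewrite mem_filter => /andP[/= Mij _] nuE; exists i, j; split => //.
case=> i [j [Mij -> /eqP nu0]]; rewrite mem_filter; apply/andP; split => //.
apply/mapP; exists (i, j) => //; rewrite mem_filter /= Mij /=.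
apply/allpairsP; exists (i, j); split => //=; rewrite mem_iota add0n /=.
  rewrite ltnNge; apply: contra nu0 => si.
  by rewrite /= /cut drop_oversize.
move: nu0; rewrite /= /cut => nu0.
have: has (fun x => j < x) (drop i mu).
  by rewrite has_filter; apply: contra nu0 => /eqP ->.
case/hasP=> x /mem_drop xs jx; apply: (leq_trans jx).
case/andP: (partsP mu) xs; case: (parts mu) => //= a s.
rewrite path_sortedE; last by move=> b c d /= H1 H2; exact: leq_trans H2 H1.
case/andP=> /allP as_ _ _; rewrite inE => /orP[/eqP -> //|]; exact: as_.
Qed.

Definition mex (s : seq nat) : nat :=
  find (fun n => n \notin s) (iota 0 (size s).+1).

Lemma mexP (s : seq nat) :
  mex s \notin s /\ (forall n, n \notin s -> mex s <= n).
Proof.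
rewrite /mex; set P := fun n => n \notin s; set t := iota 0 (size s).+1.
have hP : has P t.
  apply/negPn/negP => /hasPn nP.
  have : size t <= size s.
    apply: uniq_leq_size; first exact: iota_uniq.
    by move=> x /nP; rewrite negbK.
  by rewrite size_iota ltnn.
have lt : find P t < (size s).+1 by move: hP; rewrite has_find size_iota.
split; first by have := nth_find 0 hP; rewrite nth_iota.
move=> n ns; rewrite leqNgt; apply/negP => nf.
by have := before_find 0 nf; rewrite nth_iota ?add0n /P ?ns // (ltn_trans nf).
Qed.

(* Every move strictly decreases the sum of the parts, which therefore is enough
   fuel; grundyE is the resulting recursion.  The argument [t] is the value of
   terminal positions. *)
Fixpoint grundy_rec (t : nat) (M : moveset) (fuel : nat) (mu : int_partition)
    : nat :=
  if fuel is fuel'.+1 then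
    if options M mu is [::] then t
    else mex [seq grundy_rec t M fuel' nu | nu <- options M mu]
  else t.

Definition grundy (t : nat) (M : moveset) (mu : int_partition) : nat :=
  grundy_rec t M (sumn mu) mu.

Lemma move_sumn (M : moveset) (mu nu : int_partition) :
  move M mu nu -> sumn nu < sumn mu.
Proof.
case=> i [j [Mij -> /eqP nu0]].
have ij : (0 < i) || (0 < j).
  case: i j Mij {nu0} => [|i] [|j] //=; by rewrite (negbTE (inM00 M)).
have le_cut s : sumn [seq x - j | x <- s & j < x] + j * (s != [::]) <= sumn s
    \/ ~~ has (fun x => j < x) s.
  elim: s => [|a s IH]; first by right.
  have le s' : sumn [seq x - j | x <- s' & j < x] <= sumn s'.
    elim: s' => //= b s' IH'; case: ifP => _ /=.
      by apply: leq_add => //; exact: leq_subr.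
    exact: leq_trans IH' (leq_addl _ _).
  rewrite /=; case: ifP => ja /=; last first.
    case: IH => [|nh]; last by right.
    case: (s) => [|b s'] /= H; first by right.
    by left; apply: leq_trans H (leq_addl _ _).
  by left; rewrite muln1 addnAC subnK ?(ltnW ja) // leq_add2l.
have sm : sumn (take i mu) + sumn (drop i mu) = sumn mu.
  by rewrite -sumn_cat cat_take_drop.
move: nu0; rewrite /= /cut => nu0.
have hd : has (fun x => j < x) (drop i mu).
  by rewrite has_filter; apply: contra nu0 => /eqP ->.
have d0 : drop i mu != [::] by apply: contraL hd => /eqP ->.
case: (le_cut (drop i mu)) => [|]; last by rewrite hd.
rewrite d0 muln1 -sm => le.
case: j ij {Mij le_cut nu0 hd} le => [|j] ij le; last first.
  apply: leq_trans (leq_addl _ _); apply: leq_trans le.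
  by rewrite addnS ltnS leq_addr.
rewrite addn0 in le; rewrite -add1n; apply: leq_add le.
case/andP: (partsP mu) => _; move: d0.
case: i ij {sm} => // i _; case: (parts mu) => //= -[|a] s _ //.
Qed.

Lemma grundyE (t : nat) (M : moveset) (mu : int_partition) :
  grundy t M mu = if options M mu is [::] then t
                  else mex [seq grundy t M nu | nu <- options M mu].
Proof.
have fuelP n : forall p : int_partition, sumn p <= n -> grundy_rec t M n p = grundy t M p.
  elim/ltn_ind: n => n IH p le; rewrite /grundy.
  have no_opt : sumn p = 0 -> options M p = [::].
    move=> p0; case E: (options M p) => [//|q l].
    have /optionsP/move_sumn : q \in options M p by rewrite E mem_head.
    by rewrite p0.
  case: n IH le => [|n] IH le; first by move: le; rewrite leqn0 => /eqP ->.
  case E: (sumn p) => [|m]; first by rewrite /= no_opt.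
  move: le; rewrite E ltnS => mn /=.
  have -> : [seq grundy_rec t M n nu | nu <- options M p] =
            [seq grundy_rec t M m nu | nu <- options M p]; last by [].
  apply/eq_in_map => q /optionsP/move_sumn; rewrite E ltnS => qm.
  by rewrite (IH n) // ?(IH m) // (leq_trans qm).
rewrite -(fuelP (sumn mu).+1) //=.
case E: (options M mu) => [//|q l]; rewrite -E; congr mex.
by apply/eq_in_map => r /optionsP/move_sumn /ltnW; exact: fuelP.
Qed.

Definition sprague_grundy : moveset -> int_partition -> nat := grundy 0.
Definition misere_grundy : moveset -> int_partition -> nat := grundy 1.

Definition tl_position (t l : nat) (M : moveset) (mu : int_partition) : Prop :=
  sprague_grundy M mu = t /\ misere_grundy M mu = l.

Definition moves_to (t l : nat) (M : moveset) (mu : int_partition) : Prop :=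
  exists nu, move M mu nu /\ tl_position t l M nu.

Definition returnable (M : moveset) (la : int_partition) : Prop :=
  forall x y, position M la x -> move M x y -> ~ terminal M y ->
    (tl_position 0 1 M x -> moves_to 0 1 M y) /\
    (tl_position 1 0 M x -> moves_to 1 0 M y).

Definition forced (M : moveset) (la : int_partition) : Prop :=
  forall x y, position M la x -> move M x y ->
    (tl_position 0 1 M x -> tl_position 1 0 M y) /\
    (tl_position 1 0 M x -> tl_position 0 1 M y).

Definition tame (M : moveset) (la : int_partition) : Prop :=
  forall x, position M la x ->
    [\/ tl_position 0 1 M x, tl_position 1 0 M x | exists k, tl_position k k M x].

Definition miserable (M : moveset) (la : int_partition) : Prop :=
  forall x, position M la x ->
    [\/ tl_position 0 1 M x \/ tl_position 1 0 M x,
        ~ (moves_to 0 1 M x \/ moves_to 1 0 M x) |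
        moves_to 0 1 M x /\ moves_to 1 0 M x].

Definition family_has (prop : moveset -> int_partition -> Prop) (M : moveset)
    (P : int_partition -> Prop) : Prop :=
  forall la, P la -> prop M la.

Definition family_lacks (prop : moveset -> int_partition -> Prop) (M : moveset)
    (P : int_partition -> Prop) : Prop :=
  exists la, P la /\ ~ prop M la.

Definition queen_rel : rel nat := fun i j =>
  [|| (0 < i) && (j == 0), (i == 0) && (0 < j) | (0 < i) && (i == j)].

Definition Queen : moveset := @Moveset queen_rel isT.

Lemma is_part_five_fours (k : nat) : is_part (5 :: nseq k 4).
Proof.
apply/andP; split; last by rewrite inE mem_nseq andbF.
by case: k => //= k; elim: k.
Qed.

Definition five_fours (k : nat) : int_partition := Partition (is_part_five_fours k).

Definition S2 (la : int_partition) : Prop :=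
  nonempty la /\ exists k i j : nat, 7 <= k /\ la = subpart (five_fours k) i j.

(* Main.v *)
Require Import Defs.
From mathcomp Require Import zify.

Set Implicit Arguments.
Unset Strict Implicit.
Unset Printing Implicit Defensive.

(** Every position is a rectangle [c^m] or a rectangle with one extra box,
    [c+1, c^n] with n >= 7, where 1 <= c <= 4.  On rectangles Queen is Wythoff's
    game at (c - 1, m - 1), whose (0,1)- and (1,0)-positions with c <= 4 all have
    c, m <= 3.  So every position with c <= 3 and m >= 4 moves to positions of
    both kinds, whereas [4^6] and [4^7] move to neither, and are a (0,0)- and a
    (1,1)-position.  Hence [5, 4^n] moves to the (0,1)-position [1] and to no
    (1,0)-position, but its moves to [4^6] and [4^7] still make its two Grundy
    values equal and at least 2. *)

(** * Positions and their labels *)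

Definition augmented_rect (b : bool) (c n : nat) : seq nat := c + b :: nseq n c.

Definition in_family (s : seq nat) : Prop :=
  exists b c n, [/\ s = augmented_rect b c n, 0 < c <= 4 & b -> 7 <= n].

(* The label [(t, l)] with [t < 2] announces a [(t, l)]-position; [(2, 2)] and
   [(3, 3)] both announce a [(k, k)]-position with [k >= 2], the former with moves to
   a [(0, 1)]- and a [(1, 0)]-position, the latter with moves to a [(0, 0)]- and a
   [(1, 1)]-position. *)
Definition label (s : seq nat) : nat * nat :=
  let c := last 0 s in
  if c < head 0 s then (if c == 4 then (3, 3) else (2, 2)) else
  match c, size s with
  | 1, 1 | 2, 3 | 3, 2 => (0, 1)
  | 1, 2 | 2, 1 | 3, 3 => (1, 0)
  | 4, 6 => (0, 0)
  | 4, 7 => (1, 1)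
  | 4, m => if m < 6 then (2, 2) else (3, 3)
  | _, _ => (2, 2)
  end.

Definition option_labels (M : moveset) (x : int_partition) : seq (nat * nat) :=
  [seq label (parts y) | y <- options M x].

(** For a label [(t, l)] with [t < 2], no option may have Grundy value [t] or misère value [l]. The
    first two lists also omit [(3, 3)], which promises no move to a [(0, 1)]- or [(1, 0)]-position;
    returnability rests on this. *)
Definition allowed (p q : nat * nat) : bool :=
  match p with
  | (0, 1) => q \in [:: (1, 0); (2, 2)]
  | (1, 0) => q \in [:: (0, 1); (2, 2)]
  | (0, 0) => q \in [:: (2, 2); (3, 3)]
  | (1, 1) => q \in [:: (0, 0); (2, 2); (3, 3)]
  | _ => true
  end.

(** These options supply the small values that both mexes must see. The entry for [(0, 0)] only
    excludes terminal positions, whose values are 0 and 1. *)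
Definition required (p : nat * nat) : seq (nat * nat) :=
  match p with
  | (0, 1) => [:: (1, 0)]
  | (1, 0) => [:: (0, 1)]
  | (0, 0) => [:: (2, 2)]
  | (1, 1) => [:: (0, 0)]
  | (2, 2) => [:: (0, 1); (1, 0)]
  | _ => [:: (0, 0); (1, 1)]
  end.

Definition consistent (M : moveset) (x : int_partition) : bool :=
  let p := label (parts x) in let qs := option_labels M x in
  all (allowed p) qs &&
  ((p == (0, 1)) && nilp qs || all (mem qs) (required p)).

Definition realizes (p : nat * nat) (a b : nat) : Prop :=
  if p.1 < 2 then a = p.1 /\ b = p.2 else 2 <= a /\ a = b.

(** * Closure under moves *)

Lemma cut_in_family (i j : nat) (s : seq nat) :
  in_family s -> cut i j s <> [::] -> in_family (cut i j s).
Proof.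
have filterE m c : [seq x - j | x <- nseq m c & j < x] =
    if j < c then nseq m (c - j) else [::].
  by rewrite filter_nseq; case: ifP => _; rewrite ?map_nseq //= mul1n.
case=> b [c [n [-> c4 bn]]]; rewrite /cut; case: i => [|i] /=.
  case: (ltnP j c) => jc.
    rewrite (leq_trans jc (leq_addr _ _)) /= filterE jc => _.
    exists b, (c - j), n; split=> //; last by lia.
    by rewrite /augmented_rect -addnBAC // ltnW.
  case: b bn => bn; rewrite ?addn0 ?addn1.
    case: ifP => /= jc'; rewrite filterE ltnNge jc //= => _.
    (* Here [j = c], so only the extra box survives. *)
    by exists false, 1, 0; split=> //; congr [:: _]; lia.
  by rewrite ltnNge jc /= filterE ltnNge jc.
have -> : drop i (nseq n c) = nseq (n - i) c.
  elim: n i {bn} => [|n IH] [|i] //=; exact: IH.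
rewrite filterE; case: ltnP => // jc; case: (n - i) => [//|m] _.
by exists false, (c - j), m; split=> //; [rewrite /augmented_rect addn0|lia].
Qed.

Lemma move_in_family (M : moveset) (x y : int_partition) :
  in_family (parts x) -> move M x y -> in_family (parts y).
Proof. by move=> xF [i [j [_ -> y0]]]; exact: cut_in_family. Qed.

Lemma position_in_family (M : moveset) (x y : int_partition) :
  position M x y -> in_family (parts x) -> in_family (parts y).
Proof.
elim=> {x y} [x y xy xF|x|x y z _ IH _ IH' xF] //; last exact/IH'/IH.
exact: move_in_family xF xy.
Qed.

Lemma S2_in_family (la : int_partition) : S2 la -> in_family (parts la).
Proof.
case=> la0 [k [i [j [k7 E]]]]; move: la0; rewrite E /nonempty /=.
by apply: cut_in_family; exists true, 4, k.
Qed.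

(** * Consistency of the labels *)

Lemma mem_option_labels_rect (x : int_partition) (b : bool) (c n m : nat) :
  parts x = augmented_rect b c n -> 0 < c -> m < n ->
  label (augmented_rect false c m) \in option_labels Queen x.
Proof.
move=> xE c0 mn.
(* Removing [n - m >= 1] of the [n + 1] rows takes away the extra box and leaves [m + 1] rows. *)
have yE : parts (subpart x (n - m) 0) = augmented_rect false c m.
  rewrite /= xE /cut /augmented_rect addn0; case E: (n - m) => [|i]; first by lia.
  rewrite /=; have -> : drop i (nseq n c) = nseq m.+1 c.
    have -> : n = i + m.+1 by lia.
    by elim: i {E} => [|i IH] //=; rewrite drop0.
  by rewrite filter_nseq c0 mul1n map_nseq subn0.
rewrite -yE; apply: map_f; apply/optionsP; exists (n - m), 0; split=> //.
  by rewrite /= /queen_rel; apply/or3P; constructor 1; lia.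
by rewrite /nonempty yE.
Qed.

(** With at least eight rows, the size is beyond every exceptional case of [label]. *)
Lemma label_large (b : bool) (c n : nat) :
  0 < c <= 4 -> 6 < n ->
  label (augmented_rect b c n) = if c == 4 then (3, 3) else (2, 2).
Proof.
move=> c4 n7; have lastE : last (c + b) (nseq n c) = c.
  by case: n n7 => // n _ /=; elim: n.
rewrite /label /augmented_rect /= lastE size_nseq {lastE}.
have -> : n = (n - 7).+4.+3 by lia.
by case: b; case: c c4 => [|[|[|[|[|c]]]]] // _; case: (n - 7).
Qed.

Lemma Queen_consistent (x : int_partition) :
  in_family (parts x) -> consistent Queen x.
Proof.
case=> b [c [n [xE c4 bn]]].
have [n7 | n6] := ltnP 6 n.
  rewrite /consistent xE label_large //; apply/andP; split.
    by case: ifP => _; apply/allP.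
  have rect m : m < 7 ->
      label (augmented_rect false c m) \in option_labels Queen x.
    by move=> m7; apply: (mem_option_labels_rect xE); lia.
  (* [rect m] stands for [c^(m+1)]: the targets are [1], [1^2]; [2^3], [2]; [3^2], [3^3]; [4^6],
     [4^7]. *)
  case: c c4 rect {xE} => [|[|[|[|[|c]]]]] // _ rect; rewrite /= !andbT.
  - by rewrite (rect 0) // (rect 1).
  - by rewrite (rect 2) // (rect 0).
  - by rewrite (rect 1) // (rect 2).
  - by rewrite (rect 5) // (rect 6).
have bF : b = false by case: b bn {xE} => // /(_ isT); lia.
move: xE; rewrite {}bF {bn}; case: x => s sP /= xE; subst s.
(* Only the 28 rectangles with at most 4 columns and 7 rows remain. *)
by case: c c4 sP => [|[|[|[|[|c]]]]] // _;
  case: n n6 => [|[|[|[|[|[|[|n]]]]]]] // _ sP; vm_compute.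
Qed.

(** * From labels to Grundy values *)

Lemma mex_eq (s : seq nat) (m : nat) :
  m \notin s -> {in gtn m, forall n, n \in s} -> mex s = m.
Proof.
have [ns min] := mexP s => ms lt; apply/eqP; rewrite eqn_leq min //= leqNgt.
by apply: contra ns => /lt.
Qed.

Lemma mex_ge2 (s : seq nat) : 0 \in s -> 1 \in s -> 2 <= mex s.
Proof. by have [] := mexP s; case: (mex s) => [|[|m]] // /negPf ->. Qed.

Lemma mex_eq_mem (s t : seq nat) : s =i t -> mex s = mex t.
Proof.
move=> st; have [nt min] := mexP t; apply: mex_eq; rewrite ?st // => n nlt.
by rewrite st; apply: contraLR nlt => /min; rewrite -leqNgt.
Qed.

Lemma label_values (s : seq nat) :
  label s \in [:: (0, 1); (1, 0); (0, 0); (1, 1); (2, 2); (3, 3)].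
Proof.
rewrite /label; case: ifP => _; first by case: ifP.
by case: (last 0 s) => [|[|[|[|[|c]]]]] //;
  case: (size s) => [|[|[|[|[|[|[|[|m]]]]]]]].
Qed.

Lemma family_realizes (x : int_partition) :
  in_family (parts x) ->
  realizes (label (parts x)) (sprague_grundy Queen x) (misere_grundy Queen x).
Proof.
have [n] := ubnP (sumn x); elim: n x => // n IH x /ltnSE xn xF.
have {}IH y : y \in options Queen x ->
    realizes (label (parts y)) (sprague_grundy Queen y) (misere_grundy Queen y).
  move=> /optionsP xy; apply: IH; last exact: move_in_family xF xy.
  exact: leq_trans (move_sumn xy) xn.
have /andP[/allP ok req] := Queen_consistent xF.
(* [required] is never empty, so a terminal position must carry the label [(0, 1)]. *)
have [E | nE] := eqVneq (options Queen x) [::].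
  move: req; rewrite /sprague_grundy /misere_grundy !grundyE /option_labels E /=.
  case/orP => [/andP[/eqP -> //]|].
  by case: (label x) => [[|[|[|p]]] [|[|[|q]]]].
have {}grundyE t :
    grundy t Queen x = mex [seq grundy t Queen y | y <- options Queen x].
  by rewrite grundyE; case: (options Queen x) nE.
have {nE}req : all (mem (option_labels Queen x)) (required (label x)).
  case/orP: req => // /andP[_]; rewrite /option_labels.
  by case: (options Queen x) nE.
rewrite /sprague_grundy /misere_grundy !{}grundyE.
set A := map _ _; set B := map _ _.
have mem_AB q : q.1 < 2 -> q \in option_labels Queen x ->
    (q.1 \in A) && (q.2 \in B).
  move=> q2 /mapP[y yx qE]; move: (IH y yx); rewrite -qE /realizes q2.
  by case=> <- <-; rewrite !map_f.
have avoid v w :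
    (forall q a b, allowed (label x) q -> realizes q a b -> a != v /\ b != w) ->
    v \notin A /\ w \notin B.
  by move=> H; split; apply/mapP=> -[y yx E];
    have [] := H _ _ _ (ok _ (map_f _ yx)) (IH y yx); rewrite E eqxx.
(* An option contributes either values below 2 to both lists or one common value, so [A] and [B]
   have the same elements from 2 on. *)
have agree : 0 \in A -> 1 \in A -> 0 \in B -> 1 \in B ->
    2 <= mex A /\ mex A = mex B.
  move=> A0 A1 B0 B1; split; first exact: mex_ge2.
  apply: mex_eq_mem => -[|[|v]]; rewrite ?A0 ?A1 ?B0 ?B1 //.
  apply/mapP/mapP => -[y yx E]; exists y => //; move: (IH y yx);
    by move: (label_values (parts y)); rewrite !inE =>
         /orP[|/orP[|/orP[|/orP[|/orP[]]]]] /eqP ->;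
       rewrite /realizes /= /sprague_grundy /misere_grundy => -[]; lia.
move: (label_values (parts x)) req ok avoid; rewrite !inE.
move=> /orP[|/orP[|/orP[|/orP[|/orP[]]]]] /eqP -> /= req _ avoid.
- have [| A0 B1] := avoid 0 1.
    by move=> q a b; rewrite !inE => /orP[] /eqP -> [] /=; lia.
  have /andP[A1 B0] := mem_AB (1, 0) isT (andP req).1.
  by split; apply: mex_eq => // -[|].
- have [| A1 B0] := avoid 1 0.
    by move=> q a b; rewrite !inE => /orP[] /eqP -> [] /=; lia.
  have /andP[A0 B1] := mem_AB (0, 1) isT (andP req).1.
  by split; apply: mex_eq => // -[|].
- have [| A0 B0] := avoid 0 0.
    by move=> q a b; rewrite !inE => /orP[] /eqP -> [] /=; lia.
  by split; apply: mex_eq.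
- have [| A1 B1] := avoid 1 1.
    by move=> q a b; rewrite !inE => /or3P[] /eqP -> [] /=; lia.
  have /andP[A0 B0] := mem_AB (0, 0) isT (andP req).1.
  by split; apply: mex_eq => // -[|].
- case/and3P: req => q01 q10 _.
  have /andP[A0 B1] := mem_AB (0, 1) isT q01.
  have /andP[A1 B0] := mem_AB (1, 0) isT q10.
  exact: agree.
- case/and3P: req => q00 q11 _.
  have /andP[A0 B0] := mem_AB (0, 0) isT q00.
  have /andP[A1 B1] := mem_AB (1, 1) isT q11.
  exact: agree.
Qed.

(** Labels fix values exactly only below 2; [(2, 2)] and [(3, 3)] give just a lower bound and
    equality. *)
Lemma family_tl_position (t l : nat) (x : int_partition) :
  in_family (parts x) -> t < 2 ->
  tl_position t l Queen x <-> label (parts x) = (t, l).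
Proof.
move=> xF t2; rewrite /tl_position; have := family_realizes xF.
rewrite /realizes; case: (label x) => a b /=.
by case: ifP => ab [E1 E2]; split=> [[E3 E4]|[E3 E4]]; [congr pair| | |]; lia.
Qed.

Lemma family_moves_to (t l : nat) (x : int_partition) :
  in_family (parts x) -> t < 2 ->
  moves_to t l Queen x <-> (t, l) \in option_labels Queen x.
Proof.
move=> xF t2; split=> [[y [xy /family_tl_position yE]] | /mapP[y yx yE]].
  rewrite -yE //; first by apply/map_f/optionsP.
  exact: move_in_family xF xy.
move/optionsP: yx => xy; exists y; split=> //.
by apply/family_tl_position => //; exact: move_in_family xF xy.
Qed.

(** * The four properties *)

Lemma Queen_tame (la : int_partition) : in_family (parts la) -> tame Queen la.
Proof.
move=> laF x /position_in_family /(_ laF) xF.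
have := family_realizes xF; rewrite /tl_position.
move: (label_values (parts x)); rewrite !inE =>
    /orP[|/orP[|/orP[|/orP[|/orP[]]]]] /eqP ->; rewrite /realizes /=.
- by constructor 1.
- by constructor 2.
- by constructor 3; exists 0.
- by constructor 3; exists 1.
- by case=> _ E; constructor 3; exists (misere_grundy Queen x).
- by case=> _ E; constructor 3; exists (misere_grundy Queen x).
Qed.

(** From a [(0, 1)]-position every option is labelled [(1, 0)] or [(2, 2)], and both labels require
    a move back to [(0, 1)] unless the option is terminal; [(1, 0)] is symmetric. *)
Lemma Queen_returnable (la : int_partition) :
  in_family (parts la) -> returnable Queen la.
Proof.
move=> laF x y /position_in_family /(_ laF) xF xy yT.
have yF := move_in_family xF xy.
have /andP[/allP ok _] := Queen_consistent xF.
have {}ok : allowed (label x) (label y) by apply/ok/map_f/optionsP.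
have {yT}req : all (mem (option_labels Queen y)) (required (label y)).
  have /andP[_ /orP[/andP[_ /nilP]|//]] := Queen_consistent yF.
  rewrite /option_labels; case E: (options Queen y) => // _; case: yT => z.
  by move/optionsP; rewrite E.
split=> /family_tl_position xE; apply/family_moves_to => //; move: ok req;
  rewrite xE //= !inE => /orP[] /eqP -> /=; by [case/andP | case/and3P].
Qed.

Lemma in_S2 (k i j : nat) (la : int_partition) :
  7 <= k -> parts la = cut i j (5 :: nseq k 4) -> nonempty la -> S2 la.
Proof.
move=> k7 laE la0.
by split=> //; exists k, i, j; split=> //; exact: val_inj.
Qed.

Lemma Queen_not_miserable : ~ miserable Queen (five_fours 7).
Proof.
have F : in_family (parts (five_fours 7)) by exists true, 4, 7.
move=> /(_ _ (rt_refl _ _ _)) [|H|[_ /family_moves_to]].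
- by case=> /family_tl_position; move/(_ F isT).
(* The shift [(0, 4)] leads to [1]. *)
- by case: H; left; apply/family_moves_to => //; vm_compute.
- by move/(_ F isT); vm_compute.
Qed.

Lemma Queen_not_forced : ~ forced Queen (subpart (five_fours 7) 5 2).
Proof.
(* [x] is [2^3]; its option [2^2] has label [(2, 2)]. *)
set x := subpart _ _ _.
have xF : in_family (parts x) by exists false, 2, 2.
have y0 : nonempty (subpart x 1 0) by [].
have xy : move Queen x (subpart x 1 0) by exists 1, 0.
have yF := move_in_family xF xy.
move=> /(_ _ _ (rt_refl _ _ _) xy)[+ _].
have xE : tl_position 0 1 Queen x by exact/family_tl_position.
by move=> /(_ xE)/family_tl_position; move/(_ yF isT).
Qed.

Theorem theorem4p13 :
  family_has tame Queen S2 /\ family_lacks miserable Queen S2 /\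
  family_has returnable Queen S2 /\ family_lacks forced Queen S2.
Proof.
split; first by move=> la /S2_in_family; exact: Queen_tame.
split.
  exists (five_fours 7); split; last exact: Queen_not_miserable.
  exact: (@in_S2 7 0 0).
split; first by move=> la /S2_in_family; exact: Queen_returnable.
exists (subpart (five_fours 7) 5 2); split; last exact: Queen_not_forced.
exact: (@in_S2 7 5 2).
Qed.
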